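(* Any streaming certification scheme for $\mathrm{MinVC}_{\geq}$ whose verifier uses $m$ bits of memory and whose certificates have $c$ bits satisfies $c+m=\Omega(n^2)$ on $n$-node graphs.
   Context: $\mathrm{MinVC}_{\geq}$ takes as input a graph $G$ and a threshold $k$ and asks whether the minimum vertex cover of $G$ has size at least $k$. Inputs: an $n$-node graph on $[n]$ and threshold $k$; $k$ is given first, then the edges arrive as a stream in an arbitrary, possibly adversarial, order. A streaming certification scheme for a decision problem $P$ consists of a prover (a computationally unlimited function producing a certificate in $\{0,1\}^*$ depending only on the input, not on the edge order) and a verifier (a deterministic streaming algorithm with read-only access to the certificate that processes the stream and outputs accept or reject). Completeness: if the input satisfies $P$, some certificate makes the verifier accept for every edge order. Soundness: if the input does not satisfy $P$, the verifier rejects for every certificate and every edge order. $c$ is the certificate length and $m$ the verifier's memory excluding the certificate, as worst-case functions of $n$. *)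

(* Defs.v *)
From mathcomp Require Import all_boot.

Set Implicit Arguments.
Unset Strict Implicit.
Unset Printing Implicit Defensive.

Record sgraph (n : nat) := SGraph {
  edges : {set {set 'I_n}};
  edges_card2 : [forall e in edges, #|e| == 2]
}.

Definition vertex_cover n (G : sgraph n) (C : {set 'I_n}) : bool :=
  [forall e in edges G, [exists v in C, v \in e]].

(* The whole vertex set is a cover, so the arg min is taken over a nonempty
   family. *)
Definition min_vc n (G : sgraph n) : nat :=
  #|[arg min_(C < [set: 'I_n] | vertex_cover G C) #|C|]|.

Definition decision_problem := forall n : nat, sgraph n -> nat -> bool.

Definition MinVC_ge : decision_problem := fun n G k => k <= min_vc G.

(* Every edge occurs in the stream exactly once. *)
Definition edge_order n (G : sgraph n) (s : seq {set 'I_n}) : Prop :=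
  perm_eq s (enum (edges G)).

Definition certificate := seq bool.

Definition memory := seq bool.

Definition prover := forall n : nat, sgraph n -> nat -> certificate.

(* The certificate is an argument of every operation (read-only access) and is
   not part of the memory. The threshold is the first item read: after
   [v_init] it is available only through the memory. *)
Record verifier := Verifier {
  v_init : nat -> certificate -> nat -> memory;
  v_step : forall n : nat, certificate -> memory -> {set 'I_n} -> memory;
  v_accept : nat -> certificate -> memory -> bool
}.

Definition memory_after (V : verifier) n (w : certificate) (k : nat)
    (s : seq {set 'I_n}) : memory :=
  foldl (v_step V w) (v_init V n w k) s.

Definition accepts (V : verifier) n (w : certificate) (k : nat)
    (s : seq {set 'I_n}) : bool :=
  v_accept V n w (memory_after V w k s).

Definition complete (P : decision_problem) (Pr : prover) (V : verifier) :=
  forall n (G : sgraph n) k, P n G k ->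
  forall s, edge_order G s -> accepts V (Pr n G k) k s.

Definition sound (P : decision_problem) (V : verifier) :=
  forall n (G : sgraph n) k, ~~ P n G k ->
  forall w s, edge_order G s -> ~~ accepts V w k s.

Definition certification_scheme (P : decision_problem) (Pr : prover)
    (V : verifier) :=
  complete P Pr V /\ sound P V.

Definition certificate_bound (P : decision_problem) (Pr : prover)
    (c : nat -> nat) :=
  forall n (G : sgraph n) k, P n G k -> size (Pr n G k) <= c n.

(* Worst case over all inputs, edge orders and points of the stream, and over
   all certificates (honest or not) of the scheme's length. *)
Definition memory_bound (V : verifier) (c m : nat -> nat) :=
  forall n (G : sgraph n) k w s, size w <= c n -> edge_order G s ->
  forall i, size (memory_after V w k (take i s)) <= m n.

(* Main.v *)
(* Fooling-set argument. From subsets x, y of [t] x [t], with t = n / 4, build a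
   graph of which Alice streams the edges depending on x and then Bob those
   depending on y, and whose minimum vertex cover is at least n - 3 iff x is
   included in y. All 2^(t^2) instances (x, x) are positive, but for x <> y one
   of (x, y), (y, x) is negative. Hence the pair formed by the certificate and
   the memory at the end of Alice's part distinguishes all the instances
   (x, x), and t^2 <= c + m + 2. *)
Require Import Defs.
From mathcomp Require Import all_boot all_order all_algebra.
From mathcomp Require Import all_classical all_reals all_analysis.
From mathcomp Require Import zify.
Import numFieldNormedType.Exports.
Import Order.TTheory GRing.Theory Num.Theory.

Set Implicit Arguments.
Unset Strict Implicit.
Unset Printing Implicit Defensive.

(** * Fooling sets for streaming verifiers *)

Lemma leq_card_bitstrings (X : finType) (f g : X -> seq bool) (a b : nat) :
  injective (fun x => (f x, g x)) ->
  (forall x, size (f x) <= a) -> (forall x, size (g x) <= b) ->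
  #|X| <= 2 ^ (a + b + 2).
Proof.
(* The first [true] of [pad d s] marks where [s] starts, so padding to the fixed length [d.+1] is
   reversible. The two marker bits account for the [+ 2]. *)
pose pad d (s : seq bool) := nseq (d - size s) false ++ true :: s.
have size_pad d s : size s <= d -> size (pad d s) == d.+1.
  by move=> sd; rewrite size_cat size_nseq /=; lia.
have padK d s : drop (index true (pad d s)).+1 (pad d s) = s.
  rewrite /pad; elim: (d - size s) => [|e IHe] /=; first by rewrite drop0.
  exact: IHe.
move=> fg_inj fa gb.
pose F x := (Tuple (size_pad _ _ (fa x)), Tuple (size_pad _ _ (gb x))).
have F_inj : injective F.
  move=> x y [/(congr1 (fun s => drop (index true s).+1 s))].
  rewrite !padK => fxy /(congr1 (fun s => drop (index true s).+1 s)).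
  by rewrite !padK => gxy; apply: fg_inj; rewrite fxy gxy.
have := leq_card _ F_inj.
by rewrite card_prod !card_tuple card_bool -expnD addSn addnS addn2.
Qed.

Lemma memory_after_cat (V : verifier) n (w : certificate) k
    (s1 s2 : seq {set 'I_n}) :
  memory_after V w k (s1 ++ s2) =
  foldl (v_step V w) (memory_after V w k s1) s2.
Proof. exact: foldl_cat. Qed.

(* Alice streams the edges [A x] and Bob the edges [B y]. The pair formed by the
   certificate of [G x x] and the memory after Alice's half must determine [x]:
   if [x] and [y] share it, the verifier also accepts the two crossed inputs. *)
Lemma fooling_set (P : decision_problem) (Pr : prover) (V : verifier)
    (c m : nat -> nat) n k (X : finType) (A B : X -> {set {set 'I_n}})
    (G : X -> X -> sgraph n) :
  certification_scheme P Pr V -> certificate_bound P Pr c ->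
  memory_bound V c m ->
  (forall x y, edges (G x y) = A x :|: B y) ->
  (forall x y, [disjoint A x & B y]) ->
  (forall x, P n (G x x) k) ->
  (forall x y, P n (G x y) k -> P n (G y x) k -> x = y) ->
  #|X| <= 2 ^ (c n + m n + 2).
Proof.
move=> [complPV soundPV] Pr_c V_m GE dAB Pdiag Pcross.
pose w x := Pr n (G x x) k.
pose halfA x := enum (A x); pose halfB x := enum (B x).
have order_AB x y : edge_order (G x y) (halfA x ++ halfB y).
  apply: uniq_perm; last by move=> e; rewrite mem_cat !mem_enum GE finset.in_setU.
    rewrite cat_uniq !enum_uniq andbT /=; apply/hasPn => e.
    by rewrite !mem_enum; apply: contraTN => eA; rewrite (disjointFr (dAB x y)).
  exact: enum_uniq.
pose mem x := memory_after V (w x) k (halfA x).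
have accept_diag x : accepts V (w x) k (halfA x ++ halfB x).
  by apply: complPV (order_AB x x).
apply: (@leq_card_bitstrings X w mem) => [x y [wE memE]|x|x].
- have acceptE z : accepts V (w x) k (halfA x ++ halfB z) =
                   accepts V (w y) k (halfA y ++ halfB z).
    by rewrite /accepts !memory_after_cat -/(mem x) -/(mem y) memE wE.
  apply: Pcross; apply/negPn/negP => NP.
    by have /negP[] := soundPV _ _ _ NP (w x) _ (order_AB x y); rewrite acceptE.
  by have /negP[] := soundPV _ _ _ NP (w x) _ (order_AB y x);
    rewrite wE -acceptE.
- exact: Pr_c (Pdiag x).
(* The memory bound holds at every prefix of the stream, in particular after Alice's half. *)
- have := V_m _ _ k (w x) _ (Pr_c _ _ _ (Pdiag x)) (order_AB x x).
  by move/(_ (size (halfA x))); rewrite take_size_cat.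
Qed.

(** * Vertex covers and graphs given by relations *)

Lemma leq_min_vcP n (G : sgraph n) k :
  reflect (forall C, vertex_cover G C -> k <= #|C|) (k <= min_vc G).
Proof.
rewrite /min_vc; case: arg_minnP => [|C GC Cmin].
  apply/forall_inP => e eG; have := forall_inP (edges_card2 G) e eG.
  by case/cards2P => u [v [_ ->]]; apply/exists_inP; exists u; rewrite // !inE ?eqxx.
by apply: (iffP idP) => [kC D /Cmin|]; [exact: leq_trans | apply].
Qed.

(** Reading [r] only at [u < v] gives each edge one oriented pair, so adjacency can be given by an
    asymmetric formula. *)
Definition edges_of n (r : rel 'I_n) : {set {set 'I_n}} :=
  [set e | [exists u : 'I_n, [exists v : 'I_n, [&& u < v, r u v & e == [set u; v]]]]].

Lemma edges_ofP n (r : rel 'I_n) (e : {set 'I_n}) :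
  reflect (exists u v : 'I_n, [/\ u < v, r u v & e = [set u; v]])
    (e \in edges_of r).
Proof.
rewrite inE; apply: (iffP existsP) => [[u /existsP[v /and3P[uv ruv /eqP->]]]|].
  by exists u, v.
by move=> [u [v [uv ruv ->]]]; exists u; apply/existsP; exists v; rewrite uv ruv /=.
Qed.

Lemma set2_ord_inj n (u v u' v' : 'I_n) :
  u < v -> u' < v' -> [set u; v] = [set u'; v'] -> u = u' /\ v = v'.
Proof.
move=> uv uv' E.
have := set21 u v; have := set22 u v; rewrite E.
by move=> /set2P[] vE /set2P[] uE; subst; split=> //; lia.
Qed.

Lemma edges_of_graph n (r : rel 'I_n) : [forall e in edges_of r, #|e| == 2].
Proof.
apply/forall_inP => e /edges_ofP[u [v [uv _ ->]]].
by rewrite cards2 neq_ltn uv.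
Qed.

Definition graph_of n (r : rel 'I_n) : sgraph n := SGraph (edges_of_graph r).

Lemma vertex_cover_graph_ofP n (r : rel 'I_n) (C : {set 'I_n}) :
  reflect (forall u v : 'I_n, u < v -> r u v -> (u \in C) || (v \in C))
    (vertex_cover (graph_of r) C).
Proof.
apply: (iffP forall_inP) => [GC u v uv ruv | GC e /edges_ofP[u [v [uv ruv ->]]]].
  have /GC/exists_inP[z zC /set2P[]zE] : [set u; v] \in edges (graph_of r).
  - by apply/edges_ofP; exists u, v.
  - by rewrite -zE zC.
  - by rewrite -zE zC orbT.
by apply/exists_inP; case/orP: (GC u v uv ruv) => ?; [exists u | exists v];
  rewrite // !inE eqxx ?orbT.
Qed.

(** * The gadget graph for set inclusion *)

Section Gadget.
Variables (n t : nat).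
Hypothesis le_4t_n : 4 * t.+1 <= n.
Implicit Types (x y : {set 'I_t.+1 * 'I_t.+1}) (u v : 'I_n).

(* Blocks 0 to 3 are cliques of t + 1 vertices; the vertices of the later blocks
   are adjacent to every other vertex. *)
Definition block v := v %/ t.+1.
Definition pos v : 'I_t.+1 := inord (v %% t.+1).

(* Meaningful for u < v only. *)
Definition nonadj x y u v : bool :=
  match block u, block v with
  | 0, 1 => (pos u, pos v) \in x
  | 2, 3 => (pos u, pos v) \notin y
  | 0, 2 | 1, 3 => pos u == pos v
  | 0, 3 | 1, 2 => true
  | _, _ => false
  end.

Definition gadget x y := graph_of (fun u v => ~~ nonadj x y u v).

Definition on_alice_side u v := (block u == 0) && (block v == 1).
Definition alice_edges x :=
  edges_of (fun u v => on_alice_side u v && ((pos u, pos v) \notin x)).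
(** [finset.set0] is a placeholder: [nonadj] consults its first set only between blocks 0 and 1,
    which is Alice's side. *)
Definition bob_edges y :=
  edges_of (fun u v => ~~ on_alice_side u v && ~~ nonadj finset.set0 y u v).

Lemma edges_gadget x y : edges (gadget x y) = alice_edges x :|: bob_edges y.
Proof.
have nonadjE u v : ~~ nonadj x y u v =
    on_alice_side u v && ((pos u, pos v) \notin x) ||
    ~~ on_alice_side u v && ~~ nonadj finset.set0 y u v.
  rewrite /on_alice_side /nonadj.
  by case: (block u) (block v) => [|[|[|?]]] [|[|[|[|?]]]] //=; rewrite orbF.
apply/setP => e; rewrite finset.in_setU; apply/edges_ofP/orP.
  move=> [u [v [uv]]]; rewrite nonadjE => /orP[] ruv ->; [left | right];
  by apply/edges_ofP; exists u, v.
case=> /edges_ofP[u [v [uv ruv ->]]]; exists u, v; rewrite uv nonadjE ruv //.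
by rewrite orbT.
Qed.

Lemma disjoint_alice_bob x y : [disjoint alice_edges x & bob_edges y].
Proof.
apply/pred0P => e; apply/negP => /andP[].
move=> /edges_ofP[u [v [uv /andP[alice_uv _] ->]]].
move=> /edges_ofP[u' [v' [uv' /andP[bob_uv _]]]].
by case/(set2_ord_inj uv uv') => uE vE; move: bob_uv; rewrite -uE -vE alice_uv.
Qed.

Lemma nonadj_ltn_block x y u v : nonadj x y u v -> block u < block v < 4.
Proof.
by rewrite /nonadj; case: (block u) (block v) => [|[|[|?]]] [|[|[|[|?]]]].
Qed.

Lemma vertex_at b (p : 'I_t.+1) :
  b < 4 -> exists v : 'I_n, block v = b /\ pos v = p.
Proof.
move=> b4; have vn : b * t.+1 + p < n by have := ltn_ord p; nia.
exists (Ordinal vn); rewrite /block /pos /= divnMDl // divn_small // addn0.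
by split=> //; rewrite modnMDl modn_small // inord_val.
Qed.

(* The cover has fewer than n - 3 vertices iff its complement contains an
   independent set of size 4. Such a set takes one vertex in each of the blocks
   0, 1, 2, 3, at positions i, j, i, j with (i, j) in [x] and not in [y]. *)
Lemma gadgetP x y : (n - 3 <= min_vc (gadget x y)) = (x \subset y).
Proof.
apply/leq_min_vcP/fintype.subsetP => [cover_large [i j] xij | xy C GC].
  have [q0 [b0 p0]] := vertex_at i (isT : 0 < 4).
  have [q1 [b1 p1]] := vertex_at j (isT : 1 < 4).
  have [q2 [b2 p2]] := vertex_at i (isT : 2 < 4).
  have [q3 [b3 p3]] := vertex_at j (isT : 3 < 4).
  apply/negPn/negP => yij.
  pose S := [set v in [:: q0; q1; q2; q3]].
  have block_neq u v : block u != block v -> u != v by apply: contraNneq => ->.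
  have S4 : #|S| = 4.
    rewrite cardsE (card_uniqP _) //= !inE !negb_or.
    by rewrite !block_neq // ?(b0, b1, b2, b3).
  suff /cover_large : vertex_cover (gadget x y) (~: S).
    by rewrite cardsCs finset.setCK S4 card_ord; lia.
  apply/vertex_cover_graph_ofP => u v uv; rewrite !finset.in_setC -negb_and.
  apply: contra => /andP[].
  (* Monotonicity of [block] excludes the pairs of [S] taken in reverse order. *)
  have block_le : block u <= block v by exact/leq_div2r/ltnW.
  rewrite !inE => uS vS; move: uS vS uv block_le.
  case/or4P => /eqP-> /or4P[] /eqP->; rewrite ?ltnn //;
    by rewrite /nonadj ?(b0, b1, b2, b3) ?(p0, p1, p2, p3).
rewrite leqNgt; apply/negP => C_small.
have : 3 < #|~: C| by rewrite cardsCs finset.setCK card_ord; lia.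
(* An increasing enumeration lists four uncovered vertices in the orientation that [nonadj]
   expects. *)
have sortedC : sorted (fun u v => u < v) (enum (~: C)).
  rewrite /enum_mem -enumT; apply: sorted_filter => [? ? ?|].
    exact: ltn_trans.
  rewrite -(sorted_map (f := val : 'I_n -> nat) (e' := ltn)) val_enum_ord.
  exact: iota_ltn_sorted.
have ltn_ord_trans : transitive (fun u v => u < v).
  by move=> ? ? ?; apply: ltn_trans.
move: sortedC; rewrite (sorted_pairwise ltn_ord_trans) cardE.
have : all (mem (~: C)) (enum (~: C)) by apply/allP => u; rewrite mem_enum.
case: (enum _) => [|u0 [|u1 [|u2 [|u3 s]]]] //=.
rewrite !finset.in_setC => /and5P[C0 C1 C2 C3 _].
case/and5P=> /and4P[u01 u02 u03 _] /and3P[u12 u13 _] /andP[u23 _] _ _ _.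
have nonadjC u v : u < v -> u \notin C -> v \notin C -> nonadj x y u v.
  move=> uv uC vC; have /vertex_cover_graph_ofP/(_ _ _ uv) := GC.
  by rewrite (negPf uC) (negPf vC) => Nuv; apply/negPn/negP => /Nuv.
have N01 := nonadjC _ _ u01 C0 C1; have N02 := nonadjC _ _ u02 C0 C2.
have N13 := nonadjC _ _ u13 C1 C3; have N23 := nonadjC _ _ u23 C2 C3.
have /nonadj_ltn_block B12 := nonadjC _ _ u12 C1 C2.
have B01 := nonadj_ltn_block N01; have B23 := nonadj_ltn_block N23.
(* Four strictly increasing block numbers below 4 leave no choice. *)
have [b0 b1 b2 b3] :
    [/\ block u0 = 0, block u1 = 1, block u2 = 2 & block u3 = 3].
  move: B01 B12 B23; move: (block u0) (block u1) (block u2) (block u3).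
  by clear=> b0 b1 b2 b3; split; lia.
move: N01 N02 N13 N23; rewrite /nonadj b0 b1 b2 b3.
by move=> x01 /eqP<- /eqP<-; rewrite xy.
Qed.
End Gadget.

(** * The quadratic lower bound *)

Lemma scheme_cost_lower_bound (Pr : prover) (V : verifier) (c m : nat -> nat)
    n t :
  certification_scheme MinVC_ge Pr V -> certificate_bound MinVC_ge Pr c ->
  memory_bound V c m -> 4 * t.+1 <= n -> t.+1 ^ 2 <= c n + m n + 2.
Proof.
move=> scheme cert_c mem_m le_4t_n.
have := fooling_set (k := n - 3) scheme cert_c mem_m
  (@edges_gadget n t) (@disjoint_alice_bob n t).
rewrite -cardsT -powersetT card_powerset cardsT card_prod card_ord mulnn.
rewrite leq_exp2l //.
have gadget_MinVC (x y : {set 'I_t.+1 * 'I_t.+1}) :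
    MinVC_ge (gadget n x y) (n - 3) = (x \subset y).
  exact: gadgetP.
apply=> [x|x y]; first by rewrite gadget_MinVC.
rewrite (gadget_MinVC x y) (gadget_MinVC y x) => xy yx.
by apply/eqP; rewrite finset.eqEsubset xy.
Qed.

Local Open Scope classical_set_scope.
Local Open Scope ring_scope.

Theorem theorem18 (R : realType) (Pr : prover) (V : verifier)
    (c m : nat -> nat)
    (scheme : certification_scheme MinVC_ge Pr V)
    (cert_c : certificate_bound MinVC_ge Pr c)
    (mem_m : memory_bound V c m) :
  (fun n => (c n + m n)%:R : R) =Omega_\oo (fun n => (n ^ 2)%:R : R).
Proof.
rewrite eqOmegaE eqOmegaO; apply/eqOP; near=> k.
near=> n.
have n8 : (8 <= n)%N by near: n; exact: nbhs_infty_ge.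
(* Let [q = n %/ 4], so [2 <= q] by [n8]. Then [n <= 4 * q + 3 <= 7 * q], and
   [q ^ 2 <= c n + m n + 2] with [4 <= q ^ 2] gives [q ^ 2 <= 2 * (c n + m n)]; hence 98 = 49 *
   2. *)
have bound : (n ^ 2 <= 98 * (c n + m n))%N.
  have le_4q_n : (4 * (n %/ 4).-1.+1 <= n)%N by lia.
  have := scheme_cost_lower_bound scheme cert_c mem_m le_4q_n.
  have : (n < 4 * (n %/ 4).-1.+1 + 4)%N by lia.
  by move: (n %/ 4)%N.-1 le_4q_n => t; nia.
rewrite !ger0_norm ?ler0n //.
apply: (@le_trans _ _ (98 * (c n + m n)%:R)).
  by rewrite -natrM ler_nat.
by apply: ler_wpM2r.
Unshelve. all: by end_near.
Qed.
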